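(* Let $n \geq 4$ be an integer, let $\mathcal{R}_{n-2}$ be the canonical recycle sequence, let $U = \mathrm{reuse}_{n-1}(\mathcal{R}_{n-2})$, and let $S$ be obtained from $U$ by moving its first two entries to the end. Then for every $m \in \{2,3,\ldots,n\}$, the sequence $\mathrm{rewind}_m(S)$ (formed with parameter $n$) is a Hamilton sequence for the restricted incomplete rotator graph $\mathrm{Rot}_n(R,m)$ with $R = \{2,3,n-1,n\}$.
   Context: For $n \geq 1$, $\Pi_n$ denotes the set of strings $a_1 \cdots a_n$ that are permutations of $\{1,\ldots,n\}$. For $2 \le r \le n$, the prefix-rotation $\sigma_r$ maps $a_1 \cdots a_n$ to $a_2 \cdots a_r a_1 a_{r+1} \cdots a_n$. For $R \subseteq \{2,\ldots,n\}$ and $m \in \{1,\ldots,n\}$, the restricted incomplete rotator graph $\mathrm{Rot}_n(R,m)$ is the directed graph whose nodes are the strings of $\Pi_n$ whose last symbol is at most $m$, with an arc from $\mathbf{a}$ to $\mathbf{b}$ whenever both are nodes and $\mathbf{b} = \mathbf{a}\sigma_r$ for some $r \in R$. A Hamilton sequence for such a graph with $N$ nodes is a sequence $r_1,\ldots,r_N$ of elements of $R$ such that, with $v_0 = n\,(n{-}1)\cdots 1$ and $v_i = v_{i-1}\sigma_{r_i}$, the strings $v_0,\ldots,v_{N-1}$ are pairwise distinct and are exactly the nodes of the graph, and $v_N = v_0$. Reuse operation: $\mathrm{reuse}_k(S)$ replaces each entry $r$ of $S$ by $k$ repeated $k-1$ times followed by $k+1-r$. Recycle operation: $\mathrm{recycle}_k(S)$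 replaces each entry $r$ of $S$ by $k, k$, then $k{-}1$ repeated $r - 1$ times, then $k$ repeated $k - r - 1$ times. Canonical recycle sequences: $\mathcal{R}_1 = 1$ and $\mathcal{R}_k = \mathrm{recycle}_k(\mathcal{R}_{k-1})$ for $k>1$. Rewind operation: if $S = T, n{-}1, n{-}1$ is a sequence whose last two entries equal its maximum $n-1$, and $m \ge 2$, then $\mathrm{rewind}_m(S)$ is the concatenation of: $T, n{-}1, n$; then $m-2$ copies of the block $T, n$; then $T, n{-}1, n$; then $m-2$ copies of $n$. *)

(* Defs.v *)
From mathcomp Require Import all_boot.
Set Implicit Arguments.
Unset Strict Implicit.
Unset Printing Implicit Defensive.

Definition is_perm_string (n : nat) (a : seq nat) : bool := perm_eq a (iota 1 n).

(* a_1 ... a_n |-> a_2 ... a_r a_1 a_(r+1) ... a_n *)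
Definition sigma (r : nat) (a : seq nat) : seq nat := rot 1 (take r a) ++ drop r a.

Definition Rot_node (n m : nat) (a : seq nat) : bool :=
  is_perm_string n a && (last 0 a <= m).

Definition Rot_arc (n : nat) (R : seq nat) (m : nat) (a b : seq nat) : bool :=
  [&& Rot_node n m a, Rot_node n m b & has (fun r => b == sigma r a) R].

Definition start_string (n : nat) : seq nat := rev (iota 1 n).

(* The sequence v_1, ..., v_N obtained from v_0 = a. *)
Definition walk (a : seq nat) (rs : seq nat) : seq (seq nat) :=
  scanl (fun v r => sigma r v) a rs.

(* [belast v0 (walk v0 rs)] is v_0, ..., v_(N-1), where N = size rs.  That N is
   the number of nodes follows from the second and third clauses. *)
Definition Hamilton_seq (n : nat) (R : seq nat) (m : nat) (rs : seq nat) : Prop :=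
  let v0 := start_string n in
  let vs := belast v0 (walk v0 rs) in
  [/\ {subset rs <= R},
      uniq vs,
      forall a : seq nat, (a \in vs) = Rot_node n m a
    & last v0 (walk v0 rs) = v0].

Definition reuse (k : nat) (s : seq nat) : seq nat :=
  flatten [seq rcons (nseq k.-1 k) (k.+1 - r) | r <- s].

(* Only meant for sequences with entries in {1, ..., k-1}, so that the
   subtractions are exact. *)
Definition recycle (k : nat) (s : seq nat) : seq nat :=
  flatten [seq [:: k; k] ++ nseq (r - 1) k.-1 ++ nseq (k - r - 1) k | r <- s].

(* The value at 0 is a dummy. *)
Fixpoint recycle_seq (k : nat) : seq nat :=
  match k with
  | 0 => [::]
  | 1 => [:: 1]
  | k'.+1 => recycle k (recycle_seq k')
  end.

(* Only meant for sequences of the form T, n-1, n-1 with maximum n-1, and for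
   m >= 2. *)
Definition rewind (n m : nat) (s : seq nat) : seq nat :=
  let T := take (size s - 2) s in
  T ++ [:: n.-1; n] ++ flatten (nseq (m - 2) (rcons T n))
    ++ T ++ [:: n.-1; n] ++ nseq (m - 2) n.

Lemma Hamilton_seq_cycle n R m rs : Hamilton_seq n R m rs ->
  path (Rot_arc n R m) (start_string n) (walk (start_string n) rs).
Proof.
rewrite /Hamilton_seq; set v0 := start_string n => -[rsR _ vsP vN].
have wN b : b \in walk v0 rs -> Rot_node n m b.
  case/lastP: (walk v0 rs) vsP vN => // w x vsP.
  rewrite last_rcons => xE; move: vsP; rewrite belast_rcons => vsP.
  by rewrite mem_rcons xE -vsP.
case: rs rsR vsP {vN} wN => // r0 rs0; set rs := r0 :: rs0 => rsR vsP wN.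
have v0N : Rot_node n m v0 by rewrite -vsP /rs /= inE eqxx.
elim: rs v0 v0N rsR wN {vsP} => //= r rs IH v vN rsR wN.
have sN : Rot_node n m (sigma r v) by apply: wN; rewrite inE eqxx.
apply/andP; split.
  rewrite /Rot_arc vN sN; apply/hasP; exists r => //.
  by apply: rsR; rewrite inE eqxx.
apply: IH => // [x xrs | b bw]; first by apply: rsR; rewrite inE xrs orbT.
by apply: wN; rewrite inE bw orbT.
Qed.

Lemma recycle_seq_bounds k : all (fun r => 0 < r <= k) (recycle_seq k).
Proof.
case: k => // -[|k] //.
change (recycle_seq k.+2) with (recycle k.+2 (recycle_seq k.+1)).
apply/allP => x /flattenP[s /mapP[r _ ->]].
rewrite !inE !mem_cat => /or4P[/eqP->|/eqP->|/nseqP[-> _]|/nseqP[-> _]] //=.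
Qed.

(* The sequence to be rewound satisfies the precondition of [rewind]. *)
Lemma rewind_precondition n : 4 <= n ->
  let S := rot 2 (reuse n.-1 (recycle_seq n.-2)) in
  S = take (size S - 2) S ++ [:: n.-1; n.-1] /\ all (fun r => r <= n.-1) S.
Proof.
case: n => [|[|[|[|n]]]] // _; cbv zeta.
change n.+4.-1 with n.+3; change n.+4.-2 with n.+2.
set U := reuse _ _.
have [T UE] : exists T, U = [:: n.+3; n.+3] ++ T.
  have: recycle_seq n.+2 != [::].
    elim: {U}n => // n; case E: (recycle_seq n.+2) => [|r s] // _.
    by change (recycle_seq n.+3) with (recycle n.+3 (recycle_seq n.+2)); rewrite E.
  by rewrite /U; case: (recycle_seq n.+2) => // r s _; rewrite /reuse /=; eexists.
have Ule : all (fun r => r <= n.+3) U.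
  apply/allP => x /flattenP[s /mapP[r /(allP (recycle_seq_bounds _))/andP[r0 _] ->]].
  rewrite mem_rcons inE => /orP[/eqP->|/nseqP[-> _] //].
  by case: r r0 => // r _; rewrite subSS leq_subr.
split; last by rewrite (eq_all_r (mem_rot 2 U)).
by rewrite UE (rot_size_cat [:: _; _] T) size_cat addnK take_size_cat.
Qed.

(* Main.v *)
(* With a symbol [x] in front, a tour of the strings of length k - 1 lifts to
   length k: a block for the entry [r] leads from [x b] to [x (sigma_r b)]
   (recycling), or does so with [b] reversed (reusing), and the blocks together
   meet every string.
   Rewinding runs such a tour of the first n - 1 symbols in each class of strings
   with the same last symbol 1, ..., m in turn.  Every class but the first and the
   last is left one string too early, and the strings so skipped are consecutive
   under sigma_n, so the final entries n collect them on the way back to the start.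
   There are as many entries as strings, so covering all strings visits each
   exactly once. *)

Require Import Defs.
From mathcomp Require Import all_boot zify.

Set Implicit Arguments.
Unset Strict Implicit.
Unset Printing Implicit Defensive.

(** * Walks, their endpoints and the strings they meet *)

Definition run (a rs : seq nat) : seq nat := foldl (fun v r => sigma r v) a rs.

(** Leaving out the endpoint makes concatenated walks meet concatenated lists, and gives the list
    used in [Hamilton_seq]. *)
Definition visited (a rs : seq nat) : seq (seq nat) := belast a (walk a rs).

Lemma last_walk a rs : last a (walk a rs) = run a rs.
Proof. by elim: rs a => //= r rs IH a; rewrite IH. Qed.

Lemma run_cat a s1 s2 : run a (s1 ++ s2) = run (run a s1) s2.
Proof. exact: foldl_cat. Qed.

Lemma visited_cat a s1 s2 :
  visited a (s1 ++ s2) = visited a s1 ++ visited (run a s1) s2.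
Proof.
rewrite /visited; elim: s1 a => //= r s1 IH a; congr cons.
by rewrite -IH.
Qed.

Lemma size_visited a rs : size (visited a rs) = size rs.
Proof. by rewrite /visited size_belast size_scanl. Qed.

Lemma mem_visited_head a r rs : a \in visited a (r :: rs).
Proof. by rewrite inE eqxx. Qed.

Lemma mem_visited_run a s1 r s2 : run a s1 \in visited a (s1 ++ r :: s2).
Proof. by rewrite visited_cat mem_cat mem_visited_head orbT. Qed.

Lemma size_sigma r a : size (sigma r a) = size a.
Proof. by rewrite /sigma size_cat size_rot -size_cat cat_take_drop. Qed.

Lemma perm_sigma r a : perm_eq (sigma r a) a.
Proof. by rewrite -{2}(cat_take_drop r a) /sigma perm_cat2r perm_rot. Qed.

Lemma sigma_size k a : size a = k -> sigma k a = rot 1 a.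
Proof. by move=> <-; rewrite /sigma take_size drop_size cats0. Qed.

Lemma sigma_cons k x a : size a = k -> sigma k.+1 (x :: a) = rcons a x.
Proof. by move=> ak; rewrite sigma_size ?rot1_cons //= ak. Qed.

Lemma sigma_cons_cat y t s : sigma (size t).+1 (y :: t ++ s) = t ++ y :: s.
Proof.
by rewrite /sigma /= take_size_cat // drop_size_cat // rot1_cons cat_rcons.
Qed.

Lemma sigma_rcons r a y : r <= size a -> sigma r (rcons a y) = rcons (sigma r a) y.
Proof.
move=> ra; rewrite /sigma -cats1 takel_cat // drop_cat.
case: ltngtP ra => // [_ _|-> _]; first by rewrite catA cats1.
by rewrite subnn drop_size cats0 cats1.
Qed.

Lemma size_run a rs : size (run a rs) = size a.
Proof. by elim: rs a => //= r rs IH a; rewrite IH size_sigma. Qed.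

Lemma run_nseq_rot k a j : size a = k -> j <= k -> run a (nseq j k) = rot j a.
Proof.
move=> ak; elim: j => [|j IH] jk; first by rewrite rot0.
rewrite -addn1 nseqD run_cat IH ?(ltnW jk) //= sigma_size ?size_rot //.
by rewrite addn1 [RHS]rotS // ak.
Qed.

(** Each [sigma r] only permutes positions, so a walk can be traced backwards from its endpoint;
    this supplies the starting point in [tours_rot]. *)
Lemma run_surj a rs : exists2 a', perm_eq a' a & run a' rs = a.
Proof.
elim: rs => [|r rs [a' pa ra]]; first by exists a.
exists (rotr 1 (take r a') ++ drop r a') => /=.
  rewrite (perm_trans _ pa) // -{3}(cat_take_drop r a') perm_cat2r perm_sym.
  by rewrite -{1}(rotrK 1 (take r a')) perm_rot.
rewrite -{}ra; congr run; rewrite /sigma.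
have [ra|ar] := leqP r (size a').
  have sz : size (rotr 1 (take r a')) = r by rewrite size_rotr size_takel.
  by rewrite take_size_cat // drop_size_cat // rotrK cat_take_drop.
rewrite (take_oversize (ltnW ar)) (drop_oversize (ltnW ar)) cats0.
by rewrite take_oversize ?drop_oversize ?size_rotr ?cats0 ?rotrK // ltnW.
Qed.

(** * Simulating each entry of a walk by a block of entries *)

Section Simulation.

Variables (f : seq nat -> seq nat) (block : nat -> seq nat) (k : nat) (P : pred nat).
Hypothesis run_block :
  forall b r, size b = k -> P r -> run (f b) (block r) = f (sigma r b).

Lemma run_simul b rs : size b = k -> all P rs ->
  run (f b) (flatten (map block rs)) = f (run b rs).
Proof.
elim: rs b => //= r rs IH b sb /andP[Pr Prs].
by rewrite run_cat run_block // IH // size_sigma.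
Qed.

(** The lifted walk starts a block at [f b0], but which entry is applied to [b0] is not tracked;
    only [P r] is known about it. *)
Lemma visited_simul b rs b0 : size b = k -> all P rs -> b0 \in visited b rs ->
  exists2 r, P r &
    {subset visited (f b0) (block r) <= visited (f b) (flatten (map block rs))}.
Proof.
elim: rs b => //= r rs IH b sb /andP[Pr Prs].
rewrite inE => /predU1P[->|b0in].
  by exists r => // w; rewrite visited_cat mem_cat => ->.
have [|r0 Pr0 sub0] := IH _ _ Prs b0in; first by rewrite size_sigma.
exists r0 => // w /sub0.
by rewrite visited_cat run_block // mem_cat orbC => ->.
Qed.

End Simulation.

(** * Walks on a prefix, and tours *)

Lemma run_rcons a y rs : all (leq^~ (size a)) rs ->
  run (rcons a y) rs = rcons (run a rs) y.
Proof.
elim: rs a => //= r rs IH a /andP[ra rsa].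
by rewrite sigma_rcons // IH // size_sigma.
Qed.

Lemma visited_rcons a y rs : all (leq^~ (size a)) rs ->
  visited (rcons a y) rs = map (rcons^~ y) (visited a rs).
Proof.
rewrite /visited; elim: rs a => //= r rs IH a /andP[ra rsa].
by rewrite sigma_rcons // IH // size_sigma.
Qed.

(** The start is arbitrary because arbitrary symbols get placed in front of or behind the toured
    string. Distinctness is left to a final count. *)
Definition tours (k : nat) (rs : seq nat) : Prop := forall a, size a = k ->
  run a rs = a /\ forall b, perm_eq b a -> b \in visited a rs.

(** The original tour is started at a preimage of [a] under its first part [s1]; as it closes up,
    its two parts can be exchanged. *)
Lemma tours_rot k i rs : tours k rs -> tours k (rot i rs).
Proof.
rewrite -{1}(cat_take_drop i rs) /rot.
set s1 := take i rs; set s2 := drop i rs => tk a ak.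
have [a' pa ra] := run_surj a s1.
have [|ra' va'] := tk a'; first by rewrite (perm_size pa).
rewrite run_cat ra in ra'; rewrite run_cat ra' ra; split=> // b ba.
have := va' b; rewrite !visited_cat !mem_cat ra ra' orbC; apply.
by rewrite (perm_trans ba) // perm_sym.
Qed.

(** * Reusing and recycling tours *)

Lemma tours_reuse k rs : all (fun r => 0 < r <= k) rs -> tours k rs ->
  tours k.+1 (reuse k.+1 rs).
Proof.
move=> rsk tk [|x a'] // [ak]; rewrite -(revK a'); move: (rev a') (size_rev a').
rewrite {}ak => b bk {a'}.
have rb b0 r : size b0 = k -> 0 < r <= k ->
    run (x :: rev b0) (rcons (nseq k k.+1) (k.+2 - r)) = x :: rev (sigma r b0).
  move=> b0k /andP[r0 rk].
  case: r r0 rk => // r _ rk.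
  have [y [t [s [b0E tr]]]] : exists y t s, b0 = y :: t ++ s /\ size t = r.
    case: b0 b0k => [|y t'] /=; first by lia.
    move=> tk'; exists y, (take r t'), (drop r t').
    by rewrite cat_take_drop size_takel //; lia.
  have sE : k.+2 - r.+1 = (size (x :: rev s)).+1.
    by move: b0k; rewrite b0E /= size_cat size_rev; lia.
  have wk : size (x :: rev b0) = k.+1 by rewrite /= size_rev b0k.
  (* The [k] rotations bring the last symbol [y] to the front; the final entry inserts it between
     [rev s] and [rev t]. *)
  rewrite sE -tr -cats1 run_cat run_nseq_rot // b0E sigma_cons_cat.
  have -> : x :: rev (y :: t ++ s) = (x :: rev s ++ rev t) ++ [:: y].
    by rewrite rev_cons rev_cat cats1.
  rewrite [k](_ : _ = size (x :: rev s ++ rev t)); last first.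
    by move: b0k; rewrite b0E /= !size_cat !size_rev; lia.
  rewrite rot_size_cat cat1s -[_ :: (_ ++ _)]/((x :: rev s) ++ rev t).
  rewrite /run /foldl sigma_cons_cat.
  by rewrite rev_cat rev_cons cat_rcons.
case: (tk b bk) => rb1 vb.
split=> [|c pc].
  by rewrite /reuse (run_simul (f := fun b => x :: rev b) rb bk rsk) rb1.
have xc : x \in c by rewrite (perm_mem pc) inE eqxx.
have ck : size c = k.+1 by rewrite (perm_size pc) /= size_rev bk.
case/splitPr: xc pc ck => s1 s2 pc ck.
(* [c] is a rotation of [x :: s2 ++ s1], and the block starting there meets all rotations of that
   string. *)
have b0in : rev (s2 ++ s1) \in visited b rs.
  apply: vb; rewrite perm_rev -(perm_cons x) -cat_cons perm_catC.
  by rewrite (perm_trans pc) // perm_cons perm_rev.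
have [r rk] := visited_simul (f := fun b => x :: rev b) rb bk rsk b0in.
rewrite revK => /(_ (s1 ++ x :: s2)); apply; rewrite -cats1.
move: ck; rewrite size_cat /=; case: s1 {pc b0in} => [|z s1] sz.
  rewrite cats0; case: (k) => [|k'] /=; exact: mem_visited_head.
have -> : nseq k k.+1 = nseq (size s2).+1 k.+1 ++ nseq (size s1) k.+1.
  by rewrite -nseqD; congr nseq; move: sz => /=; lia.
rewrite -catA.
have -> : (z :: s1) ++ x :: s2 =
    run (x :: s2 ++ z :: s1) (nseq (size s2).+1 k.+1).
  rewrite run_nseq_rot; last by move: sz => /=; lia.
    by rewrite -[x :: s2 ++ _]/((x :: s2) ++ _) -[(size s2).+1]/(size (x :: s2)) rot_size_cat.
  by rewrite /= size_cat; move: sz => /=; lia.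
case: (nseq (size s1) _) => [|? ?]; exact: mem_visited_run.
Qed.

(* Every entry is one of the two largest possible, so the block of [r] visits
   the word with [x] in a given position for the same string, whatever [r]. *)
Lemma tours_recycle k rs : all (fun r => [&& 0 < r, k.-1 <= r & r <= k]) rs ->
  tours k rs -> tours k.+1 (recycle k.+1 rs).
Proof.
move=> rsk tk [|x b] // [bk].
(* Two entries [k.+1] send [x] and [y] to the end; the entries [k] then rotate [t ++ rcons s x]
   until [s] is in front, with [y] fixed. *)
have rpre y t s : size (y :: t ++ s) = k ->
    run (x :: y :: t ++ s) ([:: k.+1; k.+1] ++ nseq (size t) k) =
    s ++ x :: rcons t y.
  move=> sk; rewrite run_cat /=.
  rewrite sigma_cons // rcons_cons sigma_cons ?size_rcons //.
  have tsk : size (t ++ rcons s x) = k by move: sk; rewrite /= !size_cat size_rcons; lia.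
  rewrite rcons_cat run_rcons; last by apply/allP => q /nseqP[-> _]; rewrite tsk.
  rewrite run_nseq_rot //; last by rewrite -tsk size_cat leq_addr.
  by rewrite rot_size_cat cat_rcons rcons_cat rcons_cons.
have rb b0 r : size b0 = k -> [&& 0 < r, k.-1 <= r & r <= k] ->
    run (x :: b0) ([:: k.+1; k.+1] ++ nseq (r - 1) k ++ nseq (k.+1 - r - 1) k.+1)
    = x :: sigma r b0.
  move=> b0k /and3P[r0 _ rk].
  case: r r0 rk => // r _ rk.
  have [y [t [s [b0E tr]]]] : exists y t s, b0 = y :: t ++ s /\ size t = r.
    case: b0 b0k => [|y t'] /=; first by lia.
    move=> tk'; exists y, (take r t'), (drop r t').
    by rewrite cat_take_drop size_takel //; lia.
  rewrite subn1 -tr b0E sigma_cons_cat catA run_cat rpre -?b0E //.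
  have sk : k.+1 - (size t).+1 - 1 = size s.
    by move: b0k; rewrite b0E /= size_cat; lia.
  rewrite sk run_nseq_rot ?rot_size_cat ?cat_rcons //; first by rewrite cat_cons cat_rcons.
  - by move: b0k; rewrite b0E /= !size_cat /= size_rcons; lia.
  - by rewrite -sk; lia.
case: (tk b bk) => rb1 vb.
split=> [|c pc].
  by rewrite /recycle (run_simul (f := cons x) rb bk rsk) rb1.
have xc : x \in c by rewrite (perm_mem pc) inE eqxx.
have ck : size c = k.+1 by rewrite (perm_size pc) /= bk.
have [s1 [s2 cE]] : exists s1 s2 : seq nat, c = s1 ++ x :: s2.
  by case/splitPr: xc => s1 s2; exists s1, s2.
move: pc ck; rewrite {}cE {c xc} => pc; rewrite size_cat /= => ck.
have pb : perm_eq (s2 ++ s1) b.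
  by rewrite -(perm_cons x) -cat_cons perm_catC.
(* The position of [x] decides: it is in front at the start of a block, at the end after one entry,
   and elsewhere at the stage given by [rpre]. *)
case: s1 pc ck pb => [|z s1] pc ck pb.
  rewrite cats0 in pb; have [r rk] := visited_simul (f := cons x) rb bk rsk (vb _ pb).
  by apply; exact: mem_visited_head.
case/lastP: s2 pc ck pb => [|t y] pc ck pb.
  have [r rk] := visited_simul (f := cons x) rb bk rsk (vb _ pb).
  apply; rewrite cats1 -(@sigma_cons k); last by move: ck => /=; lia.
  exact: (mem_visited_run _ [:: k.+1]).
rewrite cat_rcons in pb.
have [] // := visited_simul (f := cons x) rb bk rsk (vb (y :: t ++ z :: s1) _).
  by rewrite (perm_trans _ pb) // -cat_cons -cat1s -catA perm_catCA.
move=> r /and3P[r0 kr rk]; apply.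
rewrite size_rcons /= in ck.
rewrite -rpre /= ?size_cat /=; last by lia.
(* As [size t <= k - 2 <= r - 1], every block has enough entries [k] to reach this stage, and at
   least one entry follows, as [visited] omits the endpoint. *)
rewrite (_ : nseq (r - 1) k ++ nseq (k.+1 - r - 1) k.+1 =
  nseq (size t) k ++ (nseq (r - 1 - size t) k ++ nseq (k.+1 - r - 1) k.+1)); last first.
  by rewrite catA -nseqD subnKC //; lia.
case E: (nseq (r - 1 - _) _ ++ _) => [|q u].
  by move/(congr1 size): E; rewrite size_cat !size_nseq /=; lia.
exact: (mem_visited_run _ ([:: k.+1; k.+1] ++ nseq (size t) k)).
Qed.

(** * The canonical recycle sequences, and lengths *)

Lemma recycle_seqS k : recycle_seq k.+2 = recycle k.+2 (recycle_seq k.+1).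
Proof. by []. Qed.

(** Recycling at order [k] emits only [k] and [k - 1]. This feeds [tours_recycle], and makes 2 and 3
    the only small entries after reusing. *)
Lemma recycle_seq_large k :
  all (fun r => [&& 0 < r, k.-1 <= r & r <= k]) (recycle_seq k).
Proof.
case: k => // -[|k] //; rewrite recycle_seqS.
apply/allP => x /flattenP[s /mapP[r _ ->]].
rewrite !inE !mem_cat => /or4P[/eqP->|/eqP->|/nseqP[-> _]|/nseqP[-> _]] /=; lia.
Qed.

Lemma tours_recycle_seq k : 0 < k -> tours k (recycle_seq k).
Proof.
elim: k => // -[_ _ [|x []] // _|k IH _].
  by split=> // b bx; rewrite (perm_small_eq _ bx) // mem_visited_head.
by rewrite recycle_seqS; apply: tours_recycle (recycle_seq_large _) (IH _).
Qed.

Lemma size_flatten_const (T : Type) (f : nat -> seq T) (P : pred nat) k s :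
  all P s -> (forall r, P r -> size (f r) = k) ->
  size (flatten (map f s)) = k * size s.
Proof.
move=> Ps fk; elim: s Ps => [|r s IH] /=; first by rewrite muln0.
by case/andP=> Pr Ps; rewrite size_cat fk // IH // mulnS.
Qed.

Lemma size_recycle_seq k : 0 < k -> size (recycle_seq k) = k`!.
Proof.
elim: k => // -[//|k] IH _; rewrite recycle_seqS factS -IH //.
apply: size_flatten_const (recycle_seq_large k.+1) _ => r /and3P[r0 _ rk].
by rewrite !size_cat !size_nseq /=; lia.
Qed.

Lemma size_reuse k rs : size (reuse k.+1 rs) = k.+1 * size rs.
Proof.
apply: size_flatten_const (all_predT rs) _ => r _.
by rewrite size_rcons size_nseq.
Qed.

Lemma perm_run a rs : perm_eq (run a rs) a.
Proof.
elim: rs a => //= r rs IH a; exact: perm_trans (IH _) (perm_sigma r a).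
Qed.

(** * Segments of the rewound tour inside one class of last symbol *)

Section Segments.

Variables (k : nat) (T : seq nat).
Hypotheses (Ttours : tours k (T ++ [:: k; k])) (Tk : all (leq^~ k) T).

(** The two entries [k] closing the tour are full rotations, so undoing them gives the string
    reached after [T]. *)
Lemma tours_run_but2 Q c d : size (Q ++ [:: c; d]) = k ->
  run (Q ++ [:: c; d]) T = [:: c, d & Q].
Proof.
move=> ak; have [+ _] := Ttours ak; rewrite run_cat.
have := size_run (Q ++ [:: c; d]) T; rewrite ak.
case: (run _ T) => [|e1 [|e2 e]]; try by move: ak; rewrite size_cat /=; lia.
move=> ek; case: k ak ek => // k1 ak [ek] /=.
rewrite sigma_cons // rcons_cons sigma_cons ?size_rcons //.
rewrite -!cats1 -catA /= => /eqP; rewrite eqseq_cat.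
  by case/andP=> /eqP-> /eqP[-> ->].
by move: ak; rewrite size_cat /=; lia.
Qed.

(** The last two alternatives are the strings to which the two closing rotations are applied. *)
Lemma tours_visited_but2 Q c d b : size (Q ++ [:: c; d]) = k ->
  perm_eq b (Q ++ [:: c; d]) ->
  [\/ b \in visited (Q ++ [:: c; d]) T, b = [:: c, d & Q] | b = d :: rcons Q c].
Proof.
move=> ak ba; have [_ /(_ b ba)] := Ttours ak.
rewrite visited_cat mem_cat tours_run_but2 // !inE.
case: k ak => [|k'] ak; first by move: ak; rewrite size_cat /=; lia.
rewrite sigma_cons; last by move: ak; rewrite size_cat /=; lia.
case/or3P=> [bT|/eqP->|/eqP->]; [exact: Or31|exact: Or32|exact: Or33].
Qed.

(** With [A = rcons Q c], [T] leads to [c d Q y] and the entry [k] to [d Q c y]; so both strings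
    left over by [T] are met before [k.+1] moves [d] behind [y]. *)
Lemma closing_segment A d y : 0 < size A -> size (rcons A d) = k ->
  run (rcons (rcons A d) y) (T ++ [:: k; k.+1]) = A ++ [:: y; d] /\
  forall b, perm_eq b (rcons A d) ->
    rcons b y \in visited (rcons (rcons A d) y) (T ++ [:: k; k.+1]).
Proof.
case/lastP: A => // Q c _; rewrite -!cats1 -!catA /= => ak.
have rT : run (Q ++ [:: c; d; y]) T = [:: c, d & rcons Q y].
  have -> : Q ++ [:: c; d; y] = rcons (Q ++ [:: c; d]) y by rewrite rcons_cat.
  by rewrite run_rcons ?ak // tours_run_but2.
have sk : sigma k [:: c, d & rcons Q y] = rcons (d :: rcons Q c) y.
  rewrite -!rcons_cons sigma_rcons; last by move: ak; rewrite size_cat /=; lia.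
  case: k ak => [|k'] ak; first by move: ak; rewrite size_cat /=; lia.
  by rewrite sigma_cons //; move: ak; rewrite size_cat /=; lia.
split=> [|b ba].
  rewrite run_cat rT /= sk rcons_cons sigma_cons.
    by rewrite -!cats1 -!catA.
  by move: ak; rewrite !size_rcons size_cat /=; lia.
rewrite visited_cat mem_cat rT !inE sk.
have -> : Q ++ [:: c; d; y] = rcons (Q ++ [:: c; d]) y by rewrite rcons_cat.
rewrite visited_rcons ?ak //.
case: (tours_visited_but2 ak ba) => [bT|->|->].
- by rewrite (map_f (rcons^~ y) bT).
- by rewrite !rcons_cons eqxx orbT.
- by rewrite eqxx !orbT.
Qed.

(** Here [k.+1] is applied already at [c d Q y], so it moves [c] behind [y] and bypasses
    [d Q c y]. *)
Lemma middle_segment Q c d y : size (Q ++ [:: c; d]) = k ->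
  run (Q ++ [:: c; d; y]) (rcons T k.+1) = d :: Q ++ [:: y; c] /\
  forall b, perm_eq b (Q ++ [:: c; d]) ->
    rcons b y \in visited (Q ++ [:: c; d; y]) (rcons T k.+1)
    \/ b = d :: rcons Q c.
Proof.
move=> ak.
have -> : Q ++ [:: c; d; y] = rcons (Q ++ [:: c; d]) y by rewrite rcons_cat.
have rT : run (rcons (Q ++ [:: c; d]) y) T = [:: c, d & rcons Q y].
  by rewrite run_rcons ?ak // tours_run_but2.
rewrite -[rcons T _]cats1; split=> [|b ba].
  rewrite run_cat rT /= sigma_cons; first by rewrite -!cats1 /= -!catA.
  by move: ak; rewrite size_cat /= size_rcons; lia.
rewrite visited_cat mem_cat rT visited_rcons ?ak // inE.
case: (tours_visited_but2 ak ba) => [bT|->|->]; last by right.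
- by left; rewrite (map_f (rcons^~ y) bT).
- by left; rewrite eqxx orbT.
Qed.

End Segments.

(** * The rewound tour through the successive classes *)

Section Rewind.

Variable n : nat.

(* Where the tour enters the class of strings with last symbol [i + 2]. *)
Definition entry i := rev (iota 1 i) ++ rev (iota i.+3 (n - i.+2)) ++ [:: i.+1; i.+2].

(* For [0 < i], the string with last symbol [i + 1] that only the final run of
   [n]s visits; for [i = 0], the start. *)
Definition skipped i := rev (iota 1 i) ++ rev (iota i.+1 (n - i)).

Lemma rev_iotaSr i p : rev (iota i p.+1) = i + p :: rev (iota i p).
Proof. by rewrite -addn1 iotaD rev_cat. Qed.

Lemma rev_iotaSl i p : rev (iota i p.+1) = rcons (rev (iota i.+1 p)) i.
Proof. by rewrite -rev_cons. Qed.

(** [skipped i.+1] reads [i.+1, ..., 1, n, ..., i.+2], a cyclic shift of the start; one rotation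
    returns the front symbol [i.+1] to the end. *)
Lemma sigma_skipped i : i < n -> sigma n (skipped i.+1) = skipped i.
Proof.
move=> ltin; rewrite /skipped rev_iotaSr cat_cons.
rewrite -[n in sigma n _](ltn_predK ltin) sigma_cons.
  by rewrite subnS -{2}(prednK (n := n - i)) ?subn_gt0 // rev_iotaSl rcons_cat.
by rewrite size_cat !size_rev !size_iota; lia.
Qed.

Lemma run_skipped i : i <= n -> run (skipped i) (nseq i n) = skipped 0.
Proof. by elim: i => //= i IH ltin; rewrite sigma_skipped // IH // ltnW. Qed.

Lemma visited_skipped i j : 0 < j <= i -> i <= n ->
  skipped j \in visited (skipped i) (nseq i n).
Proof.
elim: i => [|i IH] /=; first by lia.
move=> jS ltin; rewrite inE sigma_skipped //.
have [->|ji] := eqVneq j i.+1; first by rewrite eqxx.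
by rewrite [X in _ || X]IH ?orbT //; lia.
Qed.

Lemma skipped0 : skipped 0 = start_string n.
Proof. by rewrite /skipped subn0. Qed.

Lemma perm_start : perm_eq (skipped 0) (iota 1 n).
Proof. by rewrite skipped0 /start_string perm_rev. Qed.

Lemma perm_rcons2 (a b : seq nat) y : perm_eq (rcons a y) (rcons b y) = perm_eq a b.
Proof. by rewrite -!cats1 perm_cat2r. Qed.

Variable T : seq nat.
Hypotheses (n2 : 2 < n) (Ttours : tours n.-1 (T ++ [:: n.-1; n.-1])).
Hypothesis Tn : all (leq^~ n.-1) T.

Lemma first_segment :
  run (skipped 0) (T ++ [:: n.-1; n]) = entry 0 /\
  forall w, perm_eq w (iota 1 n) -> last 0 w = 1 ->
    w \in visited (skipped 0) (T ++ [:: n.-1; n]).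
Proof.
have sE : skipped 0 = rcons (rcons (rev (iota 3 (n - 2))) 2) 1.
  by rewrite /skipped -!rev_iotaSl; congr (rev (iota _ _)); lia.
(* With [y = 1] and [d = 2], the class of 1 is left by moving 2 to the end. *)
have [||rE vE] := closing_segment Ttours Tn (A := rev (iota 3 (n - 2))) (d := 2) 1.
- by rewrite size_rev size_iota subn_gt0.
- by rewrite size_rcons size_rev size_iota; lia.
rewrite prednK in rE vE; last by lia.
rewrite sE; split=> // w pw w1.
have {pw} : perm_eq w (skipped 0) by rewrite (perm_trans pw) // perm_sym perm_start.
case/lastP: w w1 => // b y; rewrite last_rcons => ->.
by rewrite sE perm_rcons2 => /vE.
Qed.

Lemma middle_segments i : i.+1 < n ->
  run (entry 0) (flatten (nseq i (rcons T n))) = entry i /\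
  forall j w, j < i -> perm_eq w (iota 1 n) -> last 0 w = j.+2 ->
    w \in visited (entry 0) (flatten (nseq i (rcons T n))) \/ w = skipped j.+1.
Proof.
have e0 : perm_eq (entry 0) (iota 1 n).
  by rewrite -(proj1 first_segment) (perm_trans (perm_run _ _)) ?perm_start.
elim: i => // i IH ltin; have [rE vE] := IH (ltnW ltin).
have ei : perm_eq (entry i) (iota 1 n) by rewrite -rE (perm_trans (perm_run _ _)).
set B := rcons T n; rewrite -addn1 nseqD flatten_cat /= cats0 run_cat rE.
(* This brings [entry i] into the form of [middle_segment] with [c = i.+3], [d = i.+1], [y = i.+2];
   moving [i.+3] to the end then gives [entry i.+1]. *)
pose Q := rev (iota 1 i) ++ rev (iota i.+4 (n - i.+3)).
have niE : n - i.+2 = (n - i.+3).+1 by lia.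
have eE : entry i = Q ++ [:: i.+3; i.+1; i.+2].
  by rewrite /entry niE rev_iotaSl cat_rcons /Q !catA.
have Qn : size (Q ++ [:: i.+3; i.+1]) = n.-1.
  by rewrite !size_cat !size_rev !size_iota /=; lia.
have [rS vS] := middle_segment Ttours Tn i.+2 Qn.
rewrite prednK -/B in rS vS; last by lia.
rewrite addn1; split.
  by rewrite eE rS /entry rev_iotaSr add1n /Q /= catA.
move=> j w ji pw wj; rewrite visited_cat mem_cat rE.
have [{}ji|ij] := ltnP j i.
  by case: (vE j w ji pw wj) => [->|->]; [left|right].
have {ij ji} jE : j = i by lia.
rewrite {}jE in wj *.
have {}pw : perm_eq w (entry i) by rewrite (perm_trans pw) // perm_sym.
case/lastP: w wj pw => // b y; rewrite last_rcons => ->.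
rewrite {1}eE (_ : Q ++ _ = rcons (Q ++ [:: i.+3; i.+1]) i.+2); last by rewrite rcons_cat.
rewrite perm_rcons2 => /vS [bv|->]; first by left; rewrite eE bv orbT.
(* The bypassed string [d Q c y] is [skipped i.+1]. *)
right; rewrite /skipped (_ : n - i.+1 = (n - i.+3).+2); last by lia.
by rewrite rev_iotaSr add1n !rev_iotaSl -!cats1 /Q /= -!catA.
Qed.

(** A closing segment moves [d = i.+1] to the end instead of [i.+3], so the exit is [skipped i],
    which is [i] rotations away from the start. *)
Lemma last_segment i : i.+1 < n ->
  run (entry i) (T ++ [:: n.-1; n]) = skipped i /\
  forall w, perm_eq w (iota 1 n) -> last 0 w = i.+2 ->
    w \in visited (entry i) (T ++ [:: n.-1; n]).
Proof.
move=> ltin; pose A := rev (iota 1 i) ++ rev (iota i.+3 (n - i.+2)).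
have eE : entry i = rcons (rcons A i.+1) i.+2.
  by rewrite /entry -!cats1 /A -!catA.
have ei : perm_eq (entry i) (iota 1 n).
  rewrite -(proj1 (middle_segments ltin)) (perm_trans (perm_run _ _)) //.
  by rewrite -(proj1 first_segment) (perm_trans (perm_run _ _)) ?perm_start.
have [||rE vE] := closing_segment Ttours Tn (A := A) (d := i.+1) i.+2.
- by rewrite size_cat !size_rev !size_iota; lia.
- by rewrite size_rcons size_cat !size_rev !size_iota; lia.
rewrite prednK in rE vE; last by lia.
rewrite eE; split=> [|w pw wi].
  rewrite rE /skipped (_ : n - i = (n - i.+2).+2); last by lia.
  by rewrite !rev_iotaSl -!cats1 /A -!catA.
have {pw} : perm_eq w (entry i) by rewrite (perm_trans pw) // perm_sym.
case/lastP: w wi => // b y; rewrite last_rcons => ->.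
by rewrite eE perm_rcons2 => /vE.
Qed.

End Rewind.

(** * Counting the nodes by last symbol *)

Definition nodes n m := [seq rcons b x | x <- iota 1 m, b <- permutations (rem x (iota 1 n))].

Lemma mem_nodes n m w : m <= n -> 0 < n -> (w \in nodes n m) = Rot_node n m w.
Proof.
move=> mn n0; rewrite /Rot_node /is_perm_string.
apply/allpairsPdep/andP => [[x [b [xm]]]|[pw wm]].
  rewrite mem_permutations => pb ->; rewrite last_rcons.
  move: xm; rewrite mem_iota => xm; split; last by lia.
  rewrite perm_rcons (perm_trans _ (_ : perm_eq (x :: rem x (iota 1 n)) _)) //.
    by rewrite perm_cons.
  by rewrite perm_sym perm_to_rem // mem_iota; lia.
case/lastP: w pw wm => [|b x]; first by move/perm_size; rewrite size_iota /=; lia.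
rewrite last_rcons => pw xm.
have xn : x \in iota 1 n by rewrite -(perm_mem pw) mem_rcons inE eqxx.
exists x, b; split=> //.
  by move: xn; rewrite !mem_iota; lia.
rewrite mem_permutations -(perm_cons x) -perm_rcons.
by rewrite (perm_trans pw) // perm_to_rem.
Qed.

Lemma nodes_uniq n m : uniq (nodes n m).
Proof.
apply: allpairs_uniq_dep => [|x _|].
- exact: iota_uniq.
- exact: permutations_uniq.
by move=> [x b] [x' b'] _ _ /= /rcons_inj[-> ->].
Qed.

Lemma size_nodes n m : m <= n -> size (nodes n m) = m * n.-1`!.
Proof.
move=> mn; rewrite size_allpairs_dep -[in RHS](size_iota 1 m).
have: {subset iota 1 m <= iota 1 n} by move=> x; rewrite !mem_iota; lia.
elim: (iota 1 m) => //= x s IH xs; rewrite mulSn -IH => [|y ys]; last first.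
  by apply: xs; rewrite inE ys orbT.
rewrite size_permutations ?rem_uniq ?iota_uniq // size_rem ?size_iota //.
by apply: xs; rewrite inE eqxx.
Qed.

(** * Assembling the segments and comparing lengths *)

Theorem theorem9 (n m : nat) (hn : 4 <= n) (hm : 2 <= m <= n) :
  let U := reuse n.-1 (recycle_seq n.-2) in
  let S := rot 2 U in
  Hamilton_seq n [:: 2; 3; n.-1; n] m (rewind n m S).
Proof.
move=> U S; have [SE Sle] := rewind_precondition hn; rewrite -/U -/S in SE Sle.
have Stours : tours n.-1 S.
  apply: tours_rot; rewrite /U -[n.-1]prednK; last by lia.
  apply: tours_reuse; last by apply: tours_recycle_seq; lia.
  exact: recycle_seq_bounds.
have Ssize : size S = n.-1`!.
  rewrite size_rot /U -[n.-1]prednK; last by lia.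
  by rewrite size_reuse factS size_recycle_seq //; lia.
have Sent : {subset S <= [:: 2; 3; n.-1; n]}.
  move=> r; rewrite mem_rot => /flattenP[s /mapP[q qR ->]].
  have := allP (recycle_seq_large n.-2) _ qR.
  rewrite mem_rcons !inE => qb /orP[/eqP->|/nseqP[-> _]]; last by rewrite eqxx !orbT.
  (* [q] is [n - 3] or [n - 2], so [n - q] is 3 or 2. *)
  by have : n.-1.+1 - q \in [:: 2; 3]; rewrite !inE; lia.
rewrite /rewind; set T := take (size S - 2) S in SE *.
rewrite SE in Stours.
have Tn : all (leq^~ n.-1) T by apply/allP => r /mem_take; apply: (allP Sle).
have n2 : 2 < n by lia.
have sT : size T + 2 = n.-1`! by rewrite -Ssize [in RHS]SE size_cat.
set rs := T ++ _.
have rsE : rs = (T ++ [:: n.-1; n]) ++ flatten (nseq (m - 2) (rcons T n))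
    ++ (T ++ [:: n.-1; n]) ++ nseq (m - 2) n by rewrite /rs -!catA.
have [r1 v1] := first_segment n2 Stours Tn.
have m2n : (m - 2).+1 < n by lia.
have [r2 v2] := middle_segments n2 Stours Tn m2n.
have [r3 v3] := last_segment n2 Stours Tn m2n.
have ln : m - 2 <= n by lia.
(* Each of the [m - 2] middle segments is one entry short of (n-1)!; the final [m - 2] entries [n]
   make up for it. *)
have srs : size rs = m * n.-1`!.
  rewrite rsE !size_cat size_flatten /shape map_nseq sumn_nseq size_rcons size_nseq.
  by rewrite -sT /=; nia.
have cov w : Rot_node n m w -> w \in visited (start_string n) rs.
  case/andP=> pw wm; rewrite -skipped0 rsE visited_cat r1 (visited_cat (entry n 0)) r2.
  rewrite (visited_cat (entry n _)) r3 !mem_cat.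
  (* The default value 0 of [last] cannot occur, since [w] is nonempty with positive symbols. *)
  have w0 : 0 < last 0 w.
    have : last 0 w \in iota 1 n.
      rewrite -(perm_mem pw); case: w pw {wm} => [|x w _]; last exact: mem_last.
      by move/perm_size; rewrite size_iota /=; lia.
    by rewrite mem_iota; lia.
  case wE: (last 0 w) w0 wm => [|[|j]] // _ wm; first by rewrite v1.
  (* For [j < m - 2], a string bypassed by its middle segment is met in the final run; otherwise the
     last symbol is [m]. *)
  have [jm|mj] := ltnP j (m - 2).
    have [->|->] := v2 j w jm pw wE; rewrite ?orbT //.
    by rewrite visited_skipped ?orbT //; lia.
  by rewrite v3 ?orbT // wE; lia.
have nv : {subset nodes n m <= visited (start_string n) rs}.
  by move=> w; rewrite mem_nodes; [exact: cov|lia|lia].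
have szn : size (visited (start_string n) rs) <= size (nodes n m).
  by rewrite size_visited srs size_nodes //; lia.
split.
- have Tent : all (mem [:: 2; 3; n.-1; n]) T.
    by apply/allP => r /mem_take/Sent.
  have nent : n \in [:: 2; 3; n.-1; n] by rewrite !inE eqxx !orbT.
  apply/allP; rewrite rsE !all_cat Tent /= !inE !eqxx !orbT /= all_nseq /= nent orbT andbT.
  apply/allP => r /flattenP[s /nseqP[-> _]]; rewrite mem_rcons inE.
  by case/predU1P=> [->|/(allP Tent)].
- exact: leq_size_uniq (nodes_uniq n m) nv szn.
- move=> w; have [_ <-] := uniq_min_size (nodes_uniq n m) nv szn.
  by rewrite mem_nodes //; lia.
- by rewrite last_walk -skipped0 rsE run_cat r1 run_cat r2 run_cat r3 run_skipped.
Qed.
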